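(* Let $S(x)=\sum_{n\ge 0}u_nx^{-n-1}$ be a (formal) Stieltjes function, let $\{P_n\}_{n\ge 0}$ be the corresponding sequence of monic orthogonal polynomials, and let $\{P_n^{(1)}\}_{n\ge 0}$ and $\{q_n\}_{n\ge 0}$ be the sequence of associated polynomials of the first kind and the sequence of functions of the second kind, respectively. Let $A,B,C,D$ be polynomials in $x$ with $A\neq 0$. The following statements are equivalent: (a) $S$ satisfies the Riccati equation $$A\,\mathbb{D}S=B\,\mathbb{E}_1S\,\mathbb{E}_2S+C\,\mathbb{M}S+D .$$ (b) There exist polynomials (in $x$) $l_n,\pi_n,\Theta_n$, of uniformly bounded degrees, such that for all $n\ge 1$ $$A\,\mathbb{D}P_n=(l_{n-1}+\Delta_y\pi_{n-1})\,\mathbb{E}_1P_n-\tfrac{C}{2}\,\mathbb{E}_2P_n-B\,\mathbb{E}_2P_{n-1}^{(1)}+\Theta_{n-1}\,\mathbb{E}_1P_{n-1},$$ $$A\,\mathbb{D}P_{n-1}^{(1)}=(l_{n-1}+\Delta_y\pi_{n-1})\,\mathbb{E}_1P_{n-1}^{(1)}+\tfrac{C}{2}\,\mathbb{E}_2P_{n-1}^{(1)}+D\,\mathbb{E}_2P_n+\Theta_{n-1}\,\mathbb{E}_1P_{n-2}^{(1)} .$$ (c) There exist polynomials (in $x$) $l_n,\pi_n,\Theta_n$, $n\ge -1$, of uniformly bounded degrees, with $l_{-1}=C/2$, $\pi_{-1}=0$, $\Theta_{-1}=D$, such that for all $n\ge 0$ $$A\,\mathbb{D}q_n=(l_{n-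1}+\Delta_y\pi_{n-1})\,\mathbb{E}_1q_n+\Big(B\,\mathbb{E}_1S+\tfrac{C}{2}\Big)\mathbb{E}_2q_n+\Theta_{n-1}\,\mathbb{E}_1q_{n-1}.$$
   Context: Lattice. Let $\hat a,\hat b,\hat c,\hat d,\hat e,\hat f$ be constants with $\hat a\hat c\ne0$, and let $y_1(x),y_2(x)$ be the two roots in $y$ of $$\hat a y^2+2\hat b xy+\hat c x^2+2\hat d y+2\hat e x+\hat f=0 .$$ Put $\lambda=\hat b^2-\hat a\hat c$ and $\tau=\big((\hat b^2-\hat a\hat c)(\hat d^2-\hat a\hat f)-(\hat b\hat d-\hat a\hat e)^2\big)/\hat a$; it is assumed throughout that $\lambda\tau\neq0$. Then $y_1=p-\sqrt r$, $y_2=p+\sqrt r$ with the polynomials $p(x)=-(\hat b x+\hat d)/\hat a$ and $r(x)=\frac{\lambda}{\hat a^2}\big(x+\frac{\hat b\hat d-\hat a\hat e}{\lambda}\big)^2+\frac{\tau}{\hat a\lambda}$. Write $\Delta_y=y_2-y_1=2\sqrt r$. Operators. For a function $f$: $(\mathbb{E}_jf)(x)=f(y_j(x))$ for $j=1,2$, $\ \mathbb{D}f=\dfrac{\mathbb{E}_2f-\mathbb{E}_1f}{y_2-y_1}$, $\ \mathbb{M}f=\dfrac{\mathbb{E}_1f+\mathbb{E}_2f}{2}$. For formal series in $1/x$ such as $S$ and $q_n$, $\mathbb{E}_jf$ is obtained by substituting the expansion of $y_j(x)$ at $x=\infty$ (a fixed branch of $\sqrt r$ being expanded as a formal Laurent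 series in $1/x$). Orthogonal polynomials. A formal Stieltjes function is $S(x)=\sum_{n\ge0}u_nx^{-n-1}$ with $u_0=1$ and $\det[u_{i+j}]_{i,j=0}^n\ne0$ for all $n\ge0$. The corresponding monic orthogonal polynomials $P_n$ (degree $n$) and the associated polynomials of the first kind $P^{(1)}_{n-1}$ (degree $n-1$) are determined by $S-P^{(1)}_{n-1}/P_n=\mathcal{O}(x^{-2n-1})$ as $x\to\infty$. They satisfy $P_{n+1}=(x-\beta_n)P_n-\gamma_nP_{n-1}$, $n\ge0$, with $P_{-1}=0$, $P_0=1$, and $P^{(1)}_n=(x-\beta_n)P^{(1)}_{n-1}-\gamma_nP^{(1)}_{n-2}$, $n\ge1$, with $P^{(1)}_{-1}=0$, $P^{(1)}_0=1$; here $\gamma_n\ne0$ for $n\ge1$ and $\gamma_0=u_0=1$. The functions of the second kind are $q_n=P_nS-P^{(1)}_{n-1}$ for $n\ge1$, $q_0=S$, and $q_{-1}=1$. *)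

(* Defs.v *)
From HB Require Import structures.
From mathcomp Require Import all_boot all_order all_algebra.
From mathcomp Require Import boolp classical_sets functions cardinality fsbigop.
From mathcomp Require Import zify.

Set Implicit Arguments.
Unset Strict Implicit.
Unset Printing Implicit Defensive.
Import Order.TTheory GRing.Theory Num.Theory.
Local Open Scope classical_set_scope.
Local Open Scope ring_scope.

Section Convolution.
Variable F : fieldType.
Implicit Types g h k : nat -> F.

Definition conv g h (n : nat) : F := \sum_(i < n.+1) g i * h (n - i)%N.

Lemma eq_conv g g' h h' : g =1 g' -> h =1 h' -> conv g h =1 conv g' h'.
Proof. by move=> eg eh n; apply: eq_bigr => i _; rewrite eg eh. Qed.

Lemma conv_poly g h m n : (n <= m)%N ->
  conv g h n = (\poly_(i < m.+1) g i * \poly_(i < m.+1) h i)`_n.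
Proof.
move=> nm; rewrite coefM; apply: eq_bigr => i _.
by rewrite !coef_poly !ifT //; have := ltn_ord i; lia.
Qed.

Lemma convC g h : conv g h =1 conv h g.
Proof. by move=> n; rewrite !(conv_poly _ _ (leqnn n)) mulrC. Qed.

Lemma convA g h k : conv g (conv h k) =1 conv (conv g h) k.
Proof.
move=> n; set T := fun f : nat -> F => \poly_(i < n.+1) f i.
have Tco f i : (i <= n)%N -> f i = (T f)`_i by move=> le_in; rewrite coef_poly ltnS le_in.
transitivity ((T g * (T h * T k))`_n).
  rewrite coefM; apply: eq_bigr => i _; have le_in : (i <= n)%N by have := ltn_ord i; lia.
  by rewrite (Tco g) // (conv_poly _ _ (leq_subr i n)).
rewrite mulrA coefM; apply: eq_bigr => i _; have le_in : (i <= n)%N by have := ltn_ord i; lia.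
by rewrite (conv_poly _ _ le_in) (Tco k) // leq_subr.
Qed.

Fixpoint conv_inv_seq g (n : nat) : seq F :=
  if n is m.+1 then
    let s := conv_inv_seq g m in
    rcons s (- (g 0%N)^-1 * \sum_(i < m.+1) g i.+1 * s`_(m - i))
  else [:: (g 0%N)^-1].

Definition conv_inv g n := (conv_inv_seq g n)`_n.

Lemma size_conv_inv_seq g n : size (conv_inv_seq g n) = n.+1.
Proof. by elim: n => //= n IHn; rewrite size_rcons IHn. Qed.

Lemma nth_conv_inv_seq g n i : (i <= n)%N -> (conv_inv_seq g n)`_i = conv_inv g i.
Proof.
elim: n => [|n IHn]; first by rewrite leqn0 => /eqP->.
rewrite leq_eqVlt => /orP[/eqP-> //|lt_in] /=.
by rewrite nth_rcons size_conv_inv_seq lt_in IHn.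
Qed.

Lemma conv_invP g n : g 0%N != 0 -> conv g (conv_inv g) n = (n == 0%N)%:R.
Proof.
move=> g0; case: n => [|n]; first by rewrite /conv big_ord1 /conv_inv /= divff.
rewrite /conv big_ord_recl subn0 {1}/conv_inv /= nth_rcons size_conv_inv_seq ltnn eqxx.
rewrite mulrA mulrN divff // mulN1r addrC; apply/eqP; rewrite subr_eq0; apply/eqP.
by apply: eq_bigr => i _; rewrite nth_conv_inv_seq ?leq_subr.
Qed.

End Convolution.

Section Laurent.
Variable F : fieldType.

(* f = O(x^m) at x = oo, where f k is the coefficient of x^k. *)
Definition bigO_pow (m : int) (f : int -> F) : Prop := forall k, m < k -> f k = 0.

Definition bounded_degree (f : int -> F) : bool := `[< exists m, bigO_pow m f >].

(* The field F((1/x)) of formal Laurent series in 1/x. *)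
Record laurent := Laurent { lcoef :> int -> F; _ : bounded_degree lcoef }.

HB.instance Definition _ := [isSub for lcoef].
HB.instance Definition _ := [Choice of laurent by <:].
Implicit Types f g h : laurent.

Lemma laurentP f g : lcoef f =1 lcoef g -> f = g.
Proof. by move=> fg; apply/val_inj/funext. Qed.

Lemma laurent_bound f : exists m, bigO_pow m f.
Proof. by have /asboolP := valP f. Qed.

Lemma bigO_pow_le m n (f : int -> F) : m <= n -> bigO_pow m f -> bigO_pow n f.
Proof. by move=> mn fm k nk; apply: fm; apply: le_lt_trans nk. Qed.

Lemma laurent_bound2 f g : exists m, bigO_pow m f /\ bigO_pow m g.
Proof.
have [m fm] := laurent_bound f; have [n gn] := laurent_bound g.
by exists (Num.max m n); split; [apply: bigO_pow_le fm | apply: bigO_pow_le gn];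
  rewrite le_max lexx ?orbT.
Qed.

Fact bounded_zero : bounded_degree (fun=> 0).
Proof. by apply/asboolP; exists 0. Qed.
Definition lzero := Laurent bounded_zero.

Fact bounded_opp f : bounded_degree (fun k => - f k).
Proof. by have [m fm] := laurent_bound f; apply/asboolP; exists m => k /fm->; rewrite oppr0. Qed.
Definition lopp f := Laurent (bounded_opp f).

Fact bounded_add f g : bounded_degree (fun k => f k + g k).
Proof.
have [m [fm gm]] := laurent_bound2 f g.
by apply/asboolP; exists m => k mk; rewrite fm // gm // addr0.
Qed.
Definition ladd f g := Laurent (bounded_add f g).

Fact laddA : associative ladd.
Proof. by move=> f g h; apply: laurentP => k /=; rewrite addrA. Qed.
Fact laddC : commutative ladd.
Proof. by move=> f g; apply: laurentP => k /=; rewrite addrC. Qed.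
Fact ladd0 : left_id lzero ladd.
Proof. by move=> f; apply: laurentP => k /=; rewrite add0r. Qed.
Fact laddN : left_inverse lzero lopp ladd.
Proof. by move=> f; apply: laurentP => k /=; rewrite addNr. Qed.

HB.instance Definition _ := GRing.isZmodule.Build laurent laddA laddC ladd0 laddN.

(* The summand has finite support since f and g have bounded degree. *)
Definition lmul_coef (f g : int -> F) (k : int) : F :=
  \sum_(i \in [set: int]) f i * g (k - i).

(* Coefficients listed downwards from that of x^m. *)
Definition desc (f : int -> F) (m : int) (n : nat) : F := f (m - n%:Z).

Lemma lmul_coefE (f g : int -> F) m n k : bigO_pow m f -> bigO_pow n g ->
  lmul_coef f g (m + n - k%:Z) = conv (desc f m) (desc g n) k.
Proof.
move=> fm gn; pose r := [seq m - i%:Z | i <- iota 0 k.+1].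
rewrite /lmul_coef (fsbigE r) //; last 1 first.
- move=> i _ ir; have [/fm->|im] := ltP m i; first by rewrite mul0r.
  have [/gn->|ki] := ltP n (m + n - k%:Z - i); first by rewrite mulr0.
  case/negP: ir; apply/mapP; exists `|m - i|%N; last by lia.
  by rewrite mem_iota; lia.
- rewrite /r big_map (eq_bigl xpredT) => [|i]; last by rewrite in_setT.
  rewrite -/(index_iota 0 k.+1) big_mkord; apply: eq_bigr => i _.
  by congr (_ * g _); have := ltn_ord i; lia.
by rewrite map_inj_uniq ?iota_uniq // => i j; lia.
Qed.

Lemma bigO_lmul (f g : int -> F) m n : bigO_pow m f -> bigO_pow n g ->
  bigO_pow (m + n) (lmul_coef f g).
Proof.
move=> fm gn k mnk; apply: fsbig1 => i _.
have [/fm->|im] := ltP m i; first by rewrite mul0r.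
by rewrite (gn (k - i)) ?mulr0 //; lia.
Qed.

Fact bounded_mul f g : bounded_degree (lmul_coef f g).
Proof.
have [m fm] := laurent_bound f; have [n gn] := laurent_bound g.
by apply/asboolP; exists (m + n); apply: bigO_lmul.
Qed.
Definition lmul f g := Laurent (bounded_mul f g).

Lemma eq_below m (f g : int -> F) : bigO_pow m f -> bigO_pow m g ->
  desc f m =1 desc g m -> f =1 g.
Proof.
move=> fm gm fg k; have [mk|km] := ltP m k; first by rewrite fm // gm.
by have := fg `|m - k|%N; rewrite /desc (_ : m - `|m - k|%N%:Z = k) //; lia.
Qed.

Fact lmulC : commutative lmul.
Proof.
move=> f g; have [m fm] := laurent_bound f; have [n gn] := laurent_bound g.
apply/laurentP/(@eq_below (m + n)); first exact: bigO_lmul.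
  by rewrite addrC; apply: bigO_lmul.
by move=> k; rewrite /desc /= lmul_coefE // (addrC m) lmul_coefE // convC.
Qed.

Fact lmulA : associative lmul.
Proof.
move=> f g h; have [m fm] := laurent_bound f; have [n gn] := laurent_bound g.
have [p hp] := laurent_bound h; have fg := bigO_lmul fm gn; have gh := bigO_lmul gn hp.
apply/laurentP/(@eq_below (m + n + p)); last 1 first.
- move=> k; rewrite /desc /= [RHS]lmul_coefE // -(addrA m n p) lmul_coefE //.
  transitivity (conv (desc f m) (conv (desc g n) (desc h p)) k).
    by apply: eq_conv => // i; rewrite {1}/desc lmul_coefE.
  by rewrite convA; apply: eq_conv => // i; rewrite [RHS]/desc lmul_coefE.
- by rewrite -addrA; apply: bigO_lmul.
- exact: bigO_lmul.
Qed.

Fact bounded_one : bounded_degree (fun k => (k == 0)%:R).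
Proof. by apply/asboolP; exists 0 => k; rewrite lt_neqAle eq_sym => /andP[/negPf->]. Qed.
Definition lone := Laurent bounded_one.

Fact lmul1 : left_id lone lmul.
Proof.
move=> f; apply: laurentP => k /=.
rewrite /lmul_coef (fsbigE [:: 0]) //; last first.
  by move=> i _ /=; rewrite inE => /negPf->; rewrite mul0r.
by rewrite big_cons big_nil in_setT eqxx /= mul1r subr0 addr0.
Qed.

Fact lmulDl : left_distributive lmul ladd.
Proof.
move=> f g h; have [m [fm gm]] := laurent_bound2 f g; have [n hn] := laurent_bound h.
have fgm : bigO_pow m (ladd f g) by move=> k mk /=; rewrite fm // gm // addr0.
apply/laurentP/(@eq_below (m + n)); first exact: bigO_lmul.
  by move=> k mk /=; rewrite /= (bigO_lmul fm hn mk) (bigO_lmul gm hn mk) addr0.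
move=> k; rewrite /desc /= !lmul_coefE // /conv -big_split /=.
by apply: eq_bigr => i _; rewrite /desc /= mulrDl.
Qed.

Fact lone_neq0 : lone != 0.
Proof. by apply/eqP => /(congr1 (fun f : laurent => f 0)) /eqP; rewrite /= oner_eq0. Qed.

HB.instance Definition _ :=
  GRing.Zmodule_isComNzRing.Build laurent lmulA lmulC lmul1 lmulDl lone_neq0.

Definition linv f : laurent := xget 0 [set g | g * f = 1].

Fact linvP f : f != 0 -> linv f * f = 1.
Proof.
move=> f0; rewrite /linv; case: xgetP => [g _ //|nog]; exfalso.
have [m fm] := laurent_bound f.
have [n0 fn0] : exists n, desc f m n != 0.
  apply: contrapT => all0; case/negP: f0; apply/eqP/laurentP.
  apply: (@eq_below m) => // k; apply: contrapT => /eqP fk.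
  by apply: all0; exists k.
have [n fn minn] := ex_minnP (ex_intro (fun n => desc f m n != 0) n0 fn0).
pose d := m - n%:Z; have fd : bigO_pow d f.
  move=> k dk; have [/fm//|km] := ltP m k.
  apply/eqP/negPn/negP => fk; have := minn `|m - k|%N.
  rewrite /desc (_ : m - `|m - k|%N%:Z = k) => [/(_ fk)|]; lia.
have fd0 : desc f d 0%N != 0 by rewrite /desc subr0.
pose c k := if k <= - d then conv_inv (desc f d) `|- d - k|%N else 0.
have cd : bigO_pow (- d) c by move=> k dk; rewrite /c ifF //; lia.
have cb : bounded_degree c by apply/asboolP; exists (- d).
apply: (nog (Laurent cb)); rewrite /= mulrC; apply/laurentP.
apply: (@eq_below (d - d)).
- exact: bigO_lmul.
- by rewrite subrr => k; rewrite lt_neqAle eq_sym /= => /andP[/negPf->].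
move=> k; rewrite {1}/desc /= lmul_coefE //.
transitivity (conv (desc f d) (conv_inv (desc f d)) k).
  apply: eq_conv => [i|i]; first by [].
  rewrite {1}/desc /c ifT; last by lia.
  by congr conv_inv; lia.
by rewrite conv_invP // /desc /= subrr sub0r oppr_eq0.
Qed.

Fact linv0 : linv 0 = 0.
Proof.
rewrite /linv; case: xgetP => // g _ /=.
by rewrite mulr0 => /esym/eqP; rewrite (negPf lone_neq0).
Qed.

HB.instance Definition _ := GRing.ComNzRing_isField.Build laurent linvP linv0.

Fact bounded_poly (p : {poly F}) :
  bounded_degree (fun k => if k is Posz n then p`_n else 0).
Proof.
by apply/asboolP; exists (size p)%:Z => -[n|n] // pn; rewrite nth_default // -lez_nat ltW.
Qed.
Definition laurent_poly p := Laurent (bounded_poly p).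

(* Substitution of y for x: \sum_m f_m y^m, computed coefficientwise. It is
   meant for y of degree 1, where y ^ m has degree m, so that only finitely many
   m contribute to each coefficient and the result has bounded degree; the
   default value 0 is taken only when the result has unbounded degree. *)
Definition lsubst (y f : laurent) : laurent :=
  insubd (0 : laurent) (fun k : int => \sum_(m \in [set: int]) f m * (y ^ m : laurent) k).

(* \sum_(n >= 0) u_n x^(-n-1); note that Negz n is - (n + 1). *)
Fact bounded_stieltjes (u : nat -> F) :
  bounded_degree (fun k => if k is Negz n then u n else 0).
Proof. by apply/asboolP; exists 0 => -[n|n]. Qed.
Definition stieltjes u := Laurent (bounded_stieltjes u).

End Laurent.

Notation "p %:L" := (laurent_poly p)
  (at level 2, left associativity, format "p %:L") : ring_scope.

(* The lattice a y^2 + 2 b x y + c x^2 + 2 d y + 2 e x + f = 0: its two roots in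
   y are lattice_p -/+ s, where s is either square root of lattice_r. *)
Section Lattice.
Variables (F : fieldType) (a b c d e f : F).

Definition lattice_lambda : F := b ^+ 2 - a * c.

Definition lattice_tau : F :=
  (lattice_lambda * (d ^+ 2 - a * f) - (b * d - a * e) ^+ 2) / a.

Definition lattice_p : {poly F} := - a^-1 *: (b *: 'X + d%:P).

Definition lattice_r : {poly F} :=
  (lattice_lambda / a ^+ 2) *: ('X + ((b * d - a * e) / lattice_lambda)%:P) ^+ 2
  + (lattice_tau / (a * lattice_lambda))%:P.

End Lattice.

Section Operators.
Variables (F : fieldType) (y1 y2 : laurent F).

Definition divdiff (f : laurent F) : laurent F :=
  (lsubst y2 f - lsubst y1 f) / (y2 - y1).

Definition average (f : laurent F) : laurent F :=
  (lsubst y1 f + lsubst y2 f) / 2.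

End Operators.

Section OrthogonalPolynomials.
Variable F : fieldType.

Definition regular_moments (u : nat -> F) : Prop :=
  u 0%N = 1 /\
  forall n : nat, \det (\matrix_(i < n.+1, j < n.+1) u (i + j)%N) != 0.

(* The associated polynomials P1 are indexed by int because of the convention
   P1 (-1) = 0; their values below -1 are irrelevant. *)
Record monic_OPS (S : laurent F) (P : nat -> {poly F}) (P1 : int -> {poly F}) :
    Prop := MonicOPS {
  OPS_monic : forall n, P n \is monic;
  OPS_size : forall n, size (P n) = n.+1;
  OPS1_N1 : P1 (-1) = 0;
  OPS1_size : forall n : nat, size (P1 n) = n.+1;
  OPS_approx : forall n : nat,
    bigO_pow (- n.*2.+1%:Z) (S - (P1 (n%:Z - 1))%:L / (P n)%:L)
}.

Definition second_kind (S : laurent F) (P : nat -> {poly F})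
    (P1 : int -> {poly F}) (n : int) : laurent F :=
  match n with
  | Posz 0 => S
  | Posz n' => (P n')%:L * S - (P1 (n - 1))%:L
  | Negz _ => 1 (* the convention for n = -1 *)
  end.

End OrthogonalPolynomials.

(* Main.v *)
(* Write E_j for substitution of y_j, t = A / Delta_y, h = C / 2, and let
     ric(X, Y) = t (Y_N X_P - X_N Y_P)
                 - (B X_N Y_N + h (X_N Y_P + X_P Y_N) + D X_P Y_P),
   a bilinear form on pairs (N, P).  The Riccati equation (a) says that
   ric(E_1 (S, 1), E_2 (S, 1)) = 0.  Put v_n = (P1_(n-1), P_n).  For each n the two
   relations of (b) are a linear system in the unknowns l + Delta pi and Theta,
   whose determinant is the Wronskian of v_(n-1) and v_n, a nonzero constant k.
   Its solution is
     k Theta = ric(E_1 v_n, E_2 v_n),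
     k (l + Delta pi + t) = - ric(E_1 v_(n-1), E_2 v_n),
   and conjugation Delta -> - Delta, which swaps E_1 and E_2, shows that Theta, l and
   pi are polynomials.  Since v_n = P_n (S, 1) - (q_n, 0) with q_n = O(x^(-n-1)),
   the form ric(E_1 v_m, E_2 v_n) with |m - n| <= 1 differs from
   E_1 P_m E_2 P_n ric(E_1 (S, 1), E_2 (S, 1)) by a term of bounded degree.  So under
   (a) the solution has bounded degree; conversely, if Theta has bounded degree then
   ric(E_1 (S, 1), E_2 (S, 1)) = O(x^(M - 2n)) for all n, which is (a).  Given (a),
   E_1 S times the first relation minus the second gives (c), and (c) at n = 0
   is (a). *)
Require Import Defs.
From HB Require Import structures.
From mathcomp Require Import all_boot all_order all_algebra.
From mathcomp Require Import boolp classical_sets fsbigop.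
From mathcomp Require Import zify ring.

Set Implicit Arguments.
Unset Strict Implicit.
Unset Printing Implicit Defensive.
Import Order.TTheory GRing.Theory Num.Theory.
Local Open Scope ring_scope.

(** * Degrees of Laurent series *)

Section LaurentDegree.
Variable F : fieldType.
Implicit Types (f g h : laurent F) (p : {poly F}) (m n k : int).

Lemma bigO_powD m f g : bigO_pow m f -> bigO_pow m g -> bigO_pow m (f + g).
Proof. by move=> fm gm k mk /=; rewrite fm // gm // addr0. Qed.

Lemma bigO_powN m f : bigO_pow m f -> bigO_pow m (- f).
Proof. by move=> fm k mk /=; rewrite fm // oppr0. Qed.

Lemma bigO_powB m f g : bigO_pow m f -> bigO_pow m g -> bigO_pow m (f - g).
Proof. by move=> fm gm; apply: bigO_powD => //; apply: bigO_powN. Qed.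

Lemma bigO_powM m n f g :
  bigO_pow m f -> bigO_pow n g -> bigO_pow (m + n) (f * g).
Proof. exact: bigO_lmul. Qed.

Lemma bigO_pow0 m : bigO_pow m (0 : laurent F).
Proof. by []. Qed.

Lemma bigO_pow1 : bigO_pow 0 (1 : laurent F).
Proof. by move=> k; rewrite lt_neqAle eq_sym /= => /andP[/negPf->]. Qed.

Lemma coef_top_mul m n f g :
  bigO_pow m f -> bigO_pow n g -> (f * g) (m + n) = f m * g n.
Proof.
move=> fm gn; have := lmul_coefE 0 fm gn; rewrite subr0 /= => ->.
by rewrite /conv big_ord1 /desc !subr0.
Qed.

Lemma bigO_pow_lead m n f : f m != 0 -> bigO_pow n f -> m <= n.
Proof. by move=> fm fn; rewrite leNgt; apply/negP => /fn /eqP; apply/negP. Qed.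

(** The vanishing criterion for identities that are only accessible through degree estimates: it
    yields multiplicativity of substitution and, at the end, the Riccati equation. *)
Lemma bigO_pow_all_eq0 f m : (forall n : nat, bigO_pow (m - n%:Z) f) -> f = 0.
Proof.
move=> fn; apply: laurentP => k.
by have /(_ k) -> := fn `|m - k|%N.+1; last by lia.
Qed.

Lemma laurent_lead f : f != 0 -> exists2 m, bigO_pow m f & f m != 0.
Proof.
move=> f0; have [m fm] := laurent_bound f.
apply: contrapT => nolead; case/negP: f0; apply/eqP.
apply: (@bigO_pow_all_eq0 _ m); elim => [|n IHn]; first by rewrite subr0.
move=> k lek; have [/IHn//|lekn] := ltP (m - n%:Z) k.
have -> : k = m - n%:Z by lia.
by apply: contrapT => /eqP fk; apply: nolead; exists (m - n%:Z).
Qed.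

(** In f * f^-1 = 1 the top coefficient is a product of two nonzero scalars, so the degrees of f and
    f^-1 add up to 0. *)
Lemma bigO_powV m f : bigO_pow m f -> f m != 0 -> bigO_pow (- m) (f^-1)%R.
Proof.
move=> fm f_m; have f0 : f != 0 by apply: contraNneq f_m => ->.
have [d gd g_d] := laurent_lead (invr_neq0 f0).
have := coef_top_mul fm gd; rewrite divff //= => /eqP.
have [md _|_] := eqVneq (m + d) 0; first by have -> : - m = d by lia.
by rewrite eq_sym mulf_eq0 (negPf f_m) (negPf g_d).
Qed.

Fact bounded_mono (a : F) m : bounded_degree (fun k => if k == m then a else 0).
Proof. by apply/asboolP; exists m => k; rewrite lt_neqAle eq_sym => /andP[/negPf->]. Qed.
Definition mono a m : laurent F := Laurent (bounded_mono a m).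

Lemma bigO_mono a m : bigO_pow m (mono a m).
Proof. by move=> k /=; rewrite lt_neqAle eq_sym => /andP[/negPf->]. Qed.

Lemma coef_mono_mul a m f k : (mono a m * f) k = a * f (k - m).
Proof.
rewrite /= /lmul_coef (fsbigE [:: m]) //=; last first.
  by move=> i _; rewrite inE => /negPf->; rewrite mul0r.
by rewrite big_cons big_nil in_setT eqxx addr0.
Qed.

Lemma mono_mul a a' m n : mono a m * mono a' n = mono (a * a') (m + n).
Proof.
apply: laurentP => k; rewrite coef_mono_mul /= (_ : (k - m == n) = (k == m + n)).
  by case: ifP; rewrite ?mulr0.
by apply/eqP/eqP; lia.
Qed.

Lemma laurent_polyC a : a%:P%:L = mono a 0.
Proof. by apply: laurentP => -[[|n]|n] //=; rewrite coefC. Qed.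

Lemma bigO_sub_mono m f : bigO_pow m f -> bigO_pow (m - 1) (f - mono (f m) m).
Proof.
move=> fm k mk /=; case: eqP => [->|/eqP km]; first by rewrite subrr.
by rewrite fm ?subr0 // lt_neqAle eq_sym km /=; lia.
Qed.

Fact laurent_poly_zmod : zmod_morphism (@laurent_poly F).
Proof. by move=> p r; apply: laurentP => -[n|n] /=; rewrite ?coefB ?subr0. Qed.

Fact laurent_poly_monoid : monoid_morphism (@laurent_poly F).
Proof.
split=> [|p r]; first by apply: laurentP => -[[|n]|n] /=; rewrite ?coef1.
apply: laurentP => -[n|n] /=; last first.
  rewrite /lmul_coef fsbig1 // => -[i|i] _; last by rewrite mul0r.
  by rewrite (_ : Negz n - i%:Z = Negz (n + i)) ?mulr0 //; lia.
rewrite coefM /lmul_coef (fsbigE [seq i%:Z | i <- iota 0 n.+1]).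
- rewrite big_map (eq_bigl xpredT) => [|i]; last by rewrite in_setT.
  rewrite -/(index_iota 0 n.+1) big_mkord; apply: eq_bigr => i _ /=.
  by rewrite (_ : n%:Z - i%:Z = (n - i)%N) //; have := ltn_ord i; lia.
- by rewrite map_inj_uniq ?iota_uniq // => i j [].
- by move=> i _.
case=> [i|i] _; last by rewrite mul0r.
rewrite mem_map; last by move=> ? ? [].
rewrite mem_iota add0n /= => ni.
suff -> : n%:Z - i%:Z = Negz (i - n.+1) by rewrite mulr0.
by lia.
Qed.

HB.instance Definition _ :=
  GRing.isZmodMorphism.Build _ _ (@laurent_poly F) laurent_poly_zmod.
HB.instance Definition _ :=
  GRing.isMonoidMorphism.Build _ _ (@laurent_poly F) laurent_poly_monoid.

Lemma laurent_poly_inj : injective (@laurent_poly F).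
Proof.
move=> p r eq_pr; apply/polyP => n.
by have := congr1 (fun f : laurent F => f n%:Z) eq_pr.
Qed.

Lemma bigO_poly (n : nat) p : (size p <= n.+1)%N -> bigO_pow n%:Z p%:L.
Proof. by move=> pn [k|k] nk //=; rewrite nth_default // (leq_trans pn) // -ltz_nat. Qed.

Lemma size_bigO_poly (n : nat) p : bigO_pow n%:Z p%:L -> (size p <= n.+1)%N.
Proof. by move=> pn; apply/leq_sizeP => k nk; apply: (pn k%:Z); lia. Qed.

End LaurentDegree.

(** * Substitution of a series of degree 1 as a ring morphism *)

Section Substitution.
Variables (F : fieldType) (y : laurent F).
Hypotheses (y_le1 : bigO_pow 1 y) (y_1 : y 1 != 0).
Implicit Types (f g : laurent F) (p : {poly F}) (m n k : int).

Lemma subst_neq0 : y != 0.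
Proof. by apply: contraNneq y_1 => ->. Qed.

Lemma bigO_expz m : bigO_pow m (y ^ m).
Proof.
have expn (z : laurent F) d (n : nat) : bigO_pow d z -> bigO_pow (d * n%:Z) (z ^+ n).
  move=> zd; elim: n => [|n IHn]; first by rewrite mulr0; apply: bigO_pow1.
  by rewrite exprS (_ : d * _ = d + d * n%:Z); [apply: bigO_powM | lia].
case: m => n; first by have := expn _ _ n y_le1; rewrite mul1r.
have /(expn _ _ n.+1) : bigO_pow (- 1) (y^-1)%R by apply: bigO_powV.
by rewrite NegzE exprVn mulN1r.
Qed.

(** As y ^ m has degree m, the sum inherits the degree bound of f, so the default value of [insubd]
    is not taken. *)
Lemma lsubst_coef f k :
  lsubst y f k = \sum_(m \in [set: int]%classic) f m * (y ^ m : laurent F) k.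
Proof.
have [n fn] := laurent_bound f; rewrite /lsubst insubdK //.
apply/asboolP; exists n => {}k nk; apply: fsbig1 => m _.
have [/fn->|mn] := ltP n m; first by rewrite mul0r.
by rewrite (bigO_expz (le_lt_trans mn nk)) mulr0.
Qed.

Lemma bigO_lsubst n f : bigO_pow n f -> bigO_pow n (lsubst y f).
Proof.
move=> fn k nk; rewrite lsubst_coef; apply: fsbig1 => m _.
have [/fn->|mn] := ltP n m; first by rewrite mul0r.
by rewrite (bigO_expz (le_lt_trans mn nk)) mulr0.
Qed.

(** Only exponents from k to n can contribute: f vanishes above n, and y ^ m has degree m. The range
    depends on f through [n] alone, so series with a common bound are summed over the same
    indices. *)
Lemma lsubst_coef_ord n f k : bigO_pow n f ->
  lsubst y f k = \sum_(i < `|n - k|%N.+1)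
    f (n - i%:Z) * (y ^ (n - i%:Z) : laurent F) k.
Proof.
move=> fn; rewrite lsubst_coef.
rewrite (fsbigE [seq n - i%:Z | i <- iota 0 `|n - k|%N.+1]) //; last 1 first.
- move=> m _ mr; have [/fn->|mn] := ltP n m; first by rewrite mul0r.
  have [/(bigO_expz (m := m))->|km] := ltP m k; first by rewrite mulr0.
  case/negP: mr; apply/mapP; exists `|n - m|%N; last by lia.
  by rewrite mem_iota; lia.
- rewrite big_map (eq_bigl xpredT) => [|i]; last by rewrite in_setT.
  by rewrite -/(index_iota 0 `|n - k|%N.+1) big_mkord.
by rewrite map_inj_uniq ?iota_uniq // => i j; lia.
Qed.

Fact lsubst_zmod : zmod_morphism (lsubst y).
Proof.
move=> f g; apply: laurentP => k; have [n [fn gn]] := laurent_bound2 f g.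
rewrite [RHS]/= !(@lsubst_coef_ord n) //; do ?exact: bigO_powB.
by rewrite -sumrB; apply: eq_bigr => i _ /=; rewrite mulrBl.
Qed.

Lemma lsubst_mono a m : lsubst y (mono a m) = mono a 0 * y ^ m.
Proof.
apply: laurentP => k; rewrite coef_mono_mul subr0 lsubst_coef.
rewrite (fsbigE [:: m]) //=; first by rewrite big_cons big_nil in_setT eqxx addr0.
by move=> i _; rewrite inE => /negPf->; rewrite mul0r.
Qed.

HB.instance Definition _ :=
  GRing.isZmodMorphism.Build _ _ (lsubst y) lsubst_zmod.

Lemma lsubst_mulmono a a' m n :
  lsubst y (mono a m * mono a' n) = lsubst y (mono a m) * lsubst y (mono a' n).
Proof.
rewrite mono_mul !lsubst_mono expfzDr ?subst_neq0 //.
by rewrite mulrACA mono_mul addr0.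
Qed.

(* Splitting off the leading monomials of both factors gains one power of 1/x
   in the failure of multiplicativity, so that this failure is zero. *)
Lemma lsubst_defect (K : nat) m n f g : bigO_pow m f -> bigO_pow n g ->
  bigO_pow (m + n - K%:Z) (lsubst y (f * g) - lsubst y f * lsubst y g).
Proof.
elim: K m n f g => [|K IHK] m n f g fm gn.
  rewrite subr0; apply: bigO_powB; first exact/bigO_lsubst/bigO_powM.
  by apply: bigO_powM; apply: bigO_lsubst.
have -> : m + n - K.+1%:Z = m - 1 + n - K%:Z by lia.
(* The defect is biadditive. With f0, g0 the monomials of degrees m, n of f and g, it is the sum of
   the defects of (f - f0, g), (f0, g - g0) and (f0, g0), and the last one is zero. *)
have fm' := IHK _ _ _ _ (bigO_sub_mono fm) gn.
have gn' := IHK _ _ _ _ (@bigO_mono _ (f m) m) (bigO_sub_mono gn).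
rewrite (_ : m + (n - 1) = m - 1 + n) in gn'; last by lia.
have := bigO_powD fm' gn'; congr (bigO_pow _ (lcoef _)).
have := lsubst_mulmono (f m) (g n) m n.
move: (mono (f m) m) (mono (g n) n) => f0 g0 e00.
rewrite mulrBl mulrBr !raddfB /= e00.
by move: (lsubst y _) (lsubst y _) (lsubst y _) (lsubst y _) (lsubst y _) => *; ring.
Qed.

Fact lsubst_monoid : monoid_morphism (lsubst y).
Proof.
split=> [|f g].
  have -> : 1 = mono 1 0 :> laurent F by rewrite -laurent_polyC polyC1 rmorph1.
  by rewrite lsubst_mono expr0z mulr1.
have [m fm] := laurent_bound f; have [n gn] := laurent_bound g.
apply/eqP; rewrite -subr_eq0; apply/eqP/(@bigO_pow_all_eq0 _ _ (m + n)) => K.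
exact: lsubst_defect.
Qed.

HB.instance Definition _ :=
  GRing.isMonoidMorphism.Build _ _ (lsubst y) lsubst_monoid.

Lemma lsubstC (z : F) : lsubst y z%:P%:L = z%:P%:L.
Proof. by rewrite laurent_polyC lsubst_mono expr0z mulr1. Qed.

Lemma lsubstX : lsubst y 'X%:L = y.
Proof.
have -> : 'X%:L = mono (1 : F) 1.
  by apply: laurentP => -[[|[|n]]|n]; rewrite /= ?coefX.
by rewrite lsubst_mono expr1z -laurent_polyC polyC1 rmorph1 mul1r.
Qed.

Definition lsubst_rmorphism : {rmorphism laurent F -> laurent F} := lsubst y.

End Substitution.

(** * The Riccati form *)

Section RiccatiForm.
Variable R : fieldType.
Implicit Types t B h D l k : R.

(* X1 / X0 and Y1 / Y0 are projective coordinates for E_1 S and E_2 S. *)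
Definition ric t B h D X1 X0 Y1 Y0 : R :=
  t * (Y1 * X0 - X1 * Y0)
  - (B * X1 * Y1 + h * (X1 * Y0 + Y1 * X0) + D * X0 * Y0).

(** Only the t-term is antisymmetric. With t = A / Delta, the sign change is the conjugation Delta
    -> - Delta. *)
Lemma ric_swap t B h D X1 X0 Y1 Y0 :
  ric t B h D X1 X0 Y1 Y0 = ric (- t) B h D Y1 Y0 X1 X0.
Proof. by rewrite /ric; ring. Qed.

Lemma ric_affine_eq0 t B h D X Y : ric t B h D X 1 Y 1 = 0 <->
  t * (Y - X) = B * X * Y + h * (X + Y) + D.
Proof.
rewrite /ric !mulr1; split=> [/eqP|->]; last by rewrite subrr.
by rewrite subr_eq0 => /eqP.
Qed.

Lemma ric_affine_eq0_split t B h D X Y : ric t B h D X 1 Y 1 = 0 <->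
  t * (Y - X) = h * X + (B * X + h) * Y + D.
Proof.
rewrite ric_affine_eq0.
by have -> : B * X * Y + h * (X + Y) + D = h * X + (B * X + h) * Y + D by ring.
Qed.

(** Bilinearity, applied to the decomposition P (S, 1) - (q, 0) of both pairs. *)
Lemma ric_perturb t B h D S1 S2 P1 P2 q1 q2 :
  ric t B h D (P1 * S1 - q1) P1 (P2 * S2 - q2) P2 =
    P1 * P2 * ric t B h D S1 1 S2 1
    - (P1 * ric t B h D S1 1 q2 0 + P2 * ric t B h D q1 0 S2 1
       - ric t B h D q1 0 q2 0).
Proof. by rewrite /ric; ring. Qed.

(** P1 times the second relation minus N1 times the first eliminates l. *)
Lemma ric_elim_l t B h D P1 P2 N1 N2 P1' N1' l th :
  t * (P2 - P1) = l * P1 - h * P2 - B * N2 + th * P1' ->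
  t * (N2 - N1) = l * N1 + h * N2 + D * P2 + th * N1' ->
  th * (N1' * P1 - P1' * N1) = ric t B h D N1 P1 N2 P2.
Proof.
move=> eqP eqN; have -> : ric t B h D N1 P1 N2 P2 =
    t * (N2 - N1) * P1 - t * (P2 - P1) * N1
    - (B * N1 * N2 + h * (N1 * P2 + N2 * P1) + D * P1 * P2) by rewrite /ric; ring.
by rewrite eqP eqN; ring.
Qed.

(** Cramer's rule for the two relations. The unknown next to th is l + t, because t * P1 and t * N1
    are moved to the side of l. *)
Lemma ric_solve t B h D P1 P2 N1 N2 P1' N1' l th k :
  k != 0 -> k = N1' * P1 - P1' * N1 ->
  th * k = ric t B h D N1 P1 N2 P2 ->
  (l + t) * k = - ric t B h D N1' P1' N2 P2 ->
  t * (P2 - P1) = l * P1 - h * P2 - B * N2 + th * P1' /\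
  t * (N2 - N1) = l * N1 + h * N2 + D * P2 + th * N1'.
Proof.
move=> k0 ek eth el; split; apply: (mulfI k0).
  transitivity (P1 * ((l + t) * k) - k * (t * P1) - k * (h * P2 + B * N2)
                + P1' * (th * k)); last by ring.
  by rewrite el eth ek /ric; ring.
transitivity (N1 * ((l + t) * k) - k * (t * N1) + k * (h * N2 + D * P2)
              + N1' * (th * k)); last by ring.
by rewrite el eth ek /ric; ring.
Qed.

Lemma ric_second_kind t B h D S1 S2 P1 P2 N1 N2 P1' N1' l th :
  ric t B h D S1 1 S2 1 = 0 ->
  t * (P2 - P1) = l * P1 - h * P2 - B * N2 + th * P1' ->
  t * (N2 - N1) = l * N1 + h * N2 + D * P2 + th * N1' ->
  t * ((P2 * S2 - N2) - (P1 * S1 - N1)) =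
    l * (P1 * S1 - N1) + (B * S1 + h) * (P2 * S2 - N2) + th * (P1' * S1 - N1').
Proof.
move=> ric0 eqP eqN.
(* The left side is t (P2 - P1) S1 - t (N2 - N1) + P2 t (S2 - S1), and t (S2 - S1) is expressed
   through the Riccati form. *)
transitivity (t * (P2 - P1) * S1 - t * (N2 - N1)
  + P2 * (ric t B h D S1 1 S2 1 + (B * S1 * S2 + h * (S1 + S2) + D))).
  by rewrite /ric; ring.
by rewrite ric0 eqP eqN; ring.
Qed.

End RiccatiForm.

(** * Orthogonal polynomials *)

Section OrthogonalityFacts.
Variables (F : fieldType) (u : nat -> F) (P : nat -> {poly F}).
Variable P1 : int -> {poly F}.
Let S := stieltjes u.
Let N (n : nat) := P1 (n%:Z - 1).
Hypotheses (hu : regular_moments u) (hP : monic_OPS S P P1).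

Lemma bigO_stieltjes : bigO_pow (- 1) S.
Proof. by move=> [n|n] //=; lia. Qed.

(** The right side is the moment functional applied to x^i p, so the coefficients at negative
    exponents measure orthogonality. *)
Lemma coef_poly_stieltjes (p : {poly F}) (i : nat) :
  (p%:L * S) (Negz i) = \sum_(j < size p) p`_j * u (i + j)%N.
Proof.
rewrite /= /lmul_coef (fsbigE [seq j%:Z | j <- iota 0 (size p)]) //.
- rewrite big_map (eq_bigl xpredT) => [|j]; last by rewrite in_setT.
  rewrite -[X in iota 0 X]subn0 -/(index_iota 0 (size p)) big_mkord.
  apply: eq_bigr => j _ /=.
  by rewrite (_ : Negz i - j%:Z = Negz (i + j)) //; lia.
- by rewrite map_inj_uniq ?iota_uniq // => j k [].
case=> [j|j] _; last by rewrite mul0r.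
rewrite mem_map; last by move=> ? ? [].
by rewrite mem_iota add0n -leqNgt /= => pj; rewrite nth_default ?mul0r.
Qed.

Lemma OPS_lead n : (P n)%:L n%:Z = 1.
Proof. by have /eqP := OPS_monic hP n; rewrite lead_coefE (OPS_size hP). Qed.

Lemma bigO_OPS n : bigO_pow n%:Z (P n)%:L.
Proof. by apply: bigO_poly; rewrite (OPS_size hP). Qed.

Lemma OPS_neq0 n : (P n)%:L != 0.
Proof.
by apply/eqP => Pn0; have /eqP := OPS_lead n; rewrite Pn0 eq_sym oner_eq0.
Qed.

Lemma bigO_OPSV n : bigO_pow (- n%:Z) ((P n)%:L^-1)%R.
Proof. by apply: bigO_powV; [apply: bigO_OPS | rewrite OPS_lead oner_eq0]. Qed.

(** The functions of the second kind without a separate case n = 0; there P_0 = 1 and P1 (-1) = 0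
    give back S. *)
Definition qfun (n : nat) : laurent F := (P n)%:L * S - (N n)%:L.

Lemma bigO_qfun n : bigO_pow (- n%:Z - 1) (qfun n).
Proof.
have -> : qfun n = (P n)%:L * (S - (N n)%:L / (P n)%:L).
  by rewrite mulrBr [_ * (_ / _)]mulrC divfK ?OPS_neq0.
have := bigO_powM (@bigO_OPS n) (@OPS_approx _ _ _ _ hP n).
by rewrite (_ : n%:Z + _ = - n%:Z - 1) //; lia.
Qed.

(** Otherwise P_n would be orthogonal to 1, ..., x^n, and its coefficient vector would lie in the
    kernel of an invertible Hankel matrix, although P_n is monic. *)
Lemma OPS_no_overapprox n : ~ bigO_pow (- n%:Z - 2) (qfun n).
Proof.
move=> qn; have [_ /(_ n) detn] := hu.
pose M : 'M_n.+1 := \matrix_(i, j) u (i + j)%N.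
pose v : 'rV_n.+1 := \row_j (P n)`_j.
have vM : v *m M = 0.
  apply/rowP => i; rewrite !mxE.
  have qi : qfun n (Negz i) = 0 by apply: qn; have := ltn_ord i; lia.
  rewrite -[RHS]qi /qfun [RHS]/= subr0 -[RHS]/(((P n)%:L * S) (Negz i)).
  rewrite coef_poly_stieltjes (OPS_size hP); apply: eq_bigr => j _.
  by rewrite !mxE addnC.
have Mu : M \in unitmx by rewrite unitmxE unitfE.
have v0 : v = 0 by rewrite -(mulmxK Mu v) vM mul0mx.
have := congr1 (fun w : 'rV_n.+1 => w 0 ord_max) v0; rewrite !mxE /=.
by move/eqP; have := OPS_lead n => /= ->; rewrite oner_eq0.
Qed.

(** The Casoratian of the sequences [N] and [P], which is the determinant k of the linear system for
    l and Theta. *)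
Definition wronskian n : {poly F} :=
  N n * P n.+1 - P n * N n.+1.

Lemma wronskian_qfun n :
  (wronskian n)%:L = (P n)%:L * qfun n.+1 - qfun n * (P n.+1)%:L.
Proof.
rewrite /wronskian /qfun rmorphB !rmorphM /=.
by move: (_%:L) (_%:L) (_%:L) (_%:L) => *; ring.
Qed.

(** Written as P_n q_(n+1) - q_n P_(n+1), it has terms O(x^(-2)) and O(1), so it is a constant. Were
    it zero, q_n = P_n q_(n+1) / P_(n+1) would be O(x^(-n-3)), which is too small. *)
Lemma wronskian_const n : exists2 k : F, k != 0 & wronskian n = k%:P.
Proof.
have szW : (size (wronskian n) <= 1)%N.
  apply: size_bigO_poly; rewrite wronskian_qfun; apply: bigO_powB.
    have := bigO_powM (@bigO_OPS n) (@bigO_qfun n.+1).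
    by apply: bigO_pow_le; lia.
  have := bigO_powM (@bigO_qfun n) (@bigO_OPS n.+1).
  by apply: bigO_pow_le; lia.
exists (wronskian n)`_0; last exact: size1_polyC.
apply/eqP => W0; have {}W0 : wronskian n = 0.
  by rewrite [LHS]size1_polyC // W0.
apply: (@OPS_no_overapprox n).
have -> : qfun n = (P n)%:L * qfun n.+1 * (P n.+1)%:L^-1.
  apply: (canRL (mulfK (@OPS_neq0 n.+1))); apply/eqP.
  by rewrite eq_sym -subr_eq0 -wronskian_qfun W0 rmorph0.
have := bigO_powM (bigO_powM (@bigO_OPS n) (@bigO_qfun n.+1)) (@bigO_OPSV n.+1).
by apply: bigO_pow_le; lia.
Qed.

End OrthogonalityFacts.

(** * Degree of the Riccati form on the pairs (P1_(n-1), P_n) *)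

Section RiccatiDegree.
Variable F : fieldType.
Variables (E1 E2 : {rmorphism laurent F -> laurent F}).
Hypothesis E1_bigO : forall m (f : laurent F), bigO_pow m f -> bigO_pow m (E1 f).
Hypothesis E2_bigO : forall m (f : laurent F), bigO_pow m f -> bigO_pow m (E2 f).
Variables (t B h D : laurent F).

(** [M] depends only on the coefficients of the form; this makes the later bounds uniform in n. *)
Lemma ric_bounded : exists M : int, forall i j (X1 X0 Y1 Y0 : laurent F),
  bigO_pow i X1 -> bigO_pow i X0 -> bigO_pow j Y1 -> bigO_pow j Y0 ->
  bigO_pow (M + i + j) (ric t B h D X1 X0 Y1 Y0).
Proof.
have [m1 [tm Bm]] := laurent_bound2 t B; have [m2 [hm Dm]] := laurent_bound2 h D.
have m1M : m1 <= Num.max m1 m2 by rewrite le_max lexx.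
have m2M : m2 <= Num.max m1 m2 by rewrite le_max lexx orbT.
exists (Num.max m1 m2); move: (Num.max m1 m2) m1M m2M => M m1M m2M.
have {m1M}[tM BM] : bigO_pow M t /\ bigO_pow M B by split; apply: bigO_pow_le m1M _.
have {m2M}[hM DM] : bigO_pow M h /\ bigO_pow M D by split; apply: bigO_pow_le m2M _.
move=> i j X1 X0 Y1 Y0 X1i X0i Y1j Y0j.
have mulji : forall f g : laurent F,
    bigO_pow j f -> bigO_pow i g -> bigO_pow (i + j) (f * g).
  by move=> f g fj gi; rewrite addrC; apply: bigO_powM.
rewrite -addrA /ric; apply: bigO_powB; first apply: bigO_powM => //.
  by apply: bigO_powB; [apply: mulji | apply: bigO_powM].
apply: bigO_powD; last by rewrite -mulrA; apply: bigO_powM => //; apply: bigO_powM.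
apply: bigO_powD; first by rewrite -mulrA; apply: bigO_powM => //; apply: bigO_powM.
by apply: bigO_powM => //; apply: bigO_powD; [apply: bigO_powM | apply: mulji].
Qed.

Variables (u : nat -> F) (P : nat -> {poly F}) (P1 : int -> {poly F}).
Let S := stieltjes u.
Let N (n : nat) := P1 (n%:Z - 1).
Hypothesis hP : monic_OPS S P P1.

Let ricS := ric t B h D (E1 S) 1 (E2 S) 1.
Definition ricP (m n : nat) := ric t B h D
  (E1 (N m)%:L) (E1 (P m)%:L) (E2 (N n)%:L) (E2 (P n)%:L).

Lemma ricP_perturb : exists M : int, forall m n : nat, (m <= n.+1)%N -> (n <= m.+1)%N ->
  bigO_pow M (ricP m n - E1 (P m)%:L * E2 (P n)%:L * ricS).
Proof.
have [M ricM] := ric_bounded; exists M => m n mn nm.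
have [qf NE qfO] : exists2 qf : nat -> laurent F,
    forall k, (N k)%:L = (P k)%:L * S - qf k & forall k, bigO_pow (- k%:Z - 1) (qf k).
  exists (qfun u P P1) => k; last exact: bigO_qfun hP k.
  by rewrite /qfun opprB addrC subrK.
rewrite /ricP !NE !rmorphB !rmorphM ric_perturb addrAC subrr add0r.
have q1 : bigO_pow (- m%:Z - 1) (E1 (qf m)) by apply: E1_bigO.
have q2 : bigO_pow (- n%:Z - 1) (E2 (qf n)) by apply: E2_bigO.
have p1 : bigO_pow m%:Z (E1 (P m)%:L) by apply/E1_bigO/(bigO_OPS hP).
have p2 : bigO_pow n%:Z (E2 (P n)%:L) by apply/E2_bigO/(bigO_OPS hP).
have s_le0 : bigO_pow 0 S by apply: bigO_pow_le (@bigO_stieltjes _ u).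
have s1 := E1_bigO s_le0; have s2 := E2_bigO s_le0.
have one : bigO_pow 0 (1 : laurent F) := @bigO_pow1 F.
have zero k : bigO_pow k (0 : laurent F) := @bigO_pow0 F k.
(* Each remaining term contains q_m or q_n. The degrees are at most M + m - n - 1, M + n - m - 1 and
   M - m - n - 2. *)
apply/bigO_powN/bigO_powB; first apply: bigO_powD.
- have := bigO_powM p1 (ricM _ _ _ _ _ _ s1 one q2 (zero _)); apply: bigO_pow_le; lia.
- have := bigO_powM p2 (ricM _ _ _ _ _ _ q1 (zero _) s2 one); apply: bigO_pow_le; lia.
have := ricM _ _ _ _ _ _ q1 (zero _) q2 (zero _); apply: bigO_pow_le; lia.
Qed.

Lemma ricP_bounded : ricS = 0 ->
  exists M : int, forall m n : nat, (m <= n.+1)%N -> (n <= m.+1)%N ->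
  bigO_pow M (ricP m n).
Proof.
move=> ricS0; have [M ricM] := ricP_perturb; exists M => m n mn nm.
by have := ricM m n mn nm; rewrite ricS0 mulr0 subr0.
Qed.

Lemma ricS_eq0 (M : int) : (forall n : nat, bigO_pow M (ricP n.+1 n.+1)) -> ricS = 0.
Proof.
move=> ricPM; have [M' ricM'] := ricP_perturb.
have [K [MK M'K]] : exists K, M <= K /\ M' <= K.
  by exists (Num.max M M'); rewrite !le_max !lexx orbT.
apply: (@bigO_pow_all_eq0 _ _ K) => n.
have Pn0 := OPS_neq0 hP n.+1.
(* Division by E1 P_(n+1) E2 P_(n+1) lowers the degree bound by 2 (n + 1). *)
have -> : ricS = E1 (P n.+1)%:L^-1 * E2 (P n.+1)%:L^-1 *
   (ricP n.+1 n.+1 - (ricP n.+1 n.+1 - E1 (P n.+1)%:L * E2 (P n.+1)%:L * ricS)).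
  by rewrite subKr mulrA mulrACA -!rmorphM /= mulVf // !rmorph1 !mul1r.
have Pinv := @bigO_OPSV _ _ _ _ hP n.+1.
have := bigO_powM (bigO_powM (E1_bigO Pinv) (E2_bigO Pinv))
  (bigO_powB (bigO_pow_le MK (ricPM n))
             (bigO_pow_le M'K (ricM' n.+1 n.+1 (leqnSn _) (leqnSn _)))).
by apply: bigO_pow_le; lia.
Qed.

End RiccatiDegree.

(** * Conjugation *)

Lemma laurent_nat_neq0 (F : fieldType) (n : nat) :
  (n%:R : F) != 0 -> (n%:R : laurent F) != 0.
Proof.
move=> n0; rewrite -(rmorph_nat (@laurent_poly F)) -(rmorph0 (@laurent_poly F)).
by rewrite (inj_eq (@laurent_poly_inj F)) -polyC_natr polyC_eq0.
Qed.

Section ConjugatePairs.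
Variables (F : fieldType) (E1 E2 : {rmorphism laurent F -> laurent F}).
Variables (U0 V0 r : {poly F}) (Dl : laurent F).
Hypotheses (E1C : forall c : F, E1 c%:P%:L = c%:P%:L).
Hypotheses (E2C : forall c : F, E2 c%:P%:L = c%:P%:L).
Hypotheses (E1X : E1 'X%:L = U0%:L - Dl * V0%:L).
Hypotheses (E2X : E2 'X%:L = U0%:L + Dl * V0%:L).
Hypothesis (Dl2 : Dl ^+ 2 = r%:L).
Implicit Types (z w : laurent F) (g : {poly F}).

(* The two conjugates of an element of F[x] + Delta F[x]. *)
Definition conj_pair z w := exists U V : {poly F},
  z = U%:L - Dl * V%:L /\ w = U%:L + Dl * V%:L.

Lemma conj_pair_poly g : conj_pair g%:L g%:L.
Proof. by exists g, 0; rewrite rmorph0 mulr0 subr0 addr0. Qed.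

Lemma conj_pairC z w : conj_pair z w -> conj_pair w z.
Proof.
by case=> U [V [-> ->]]; exists U, (- V); rewrite rmorphN mulrN opprK.
Qed.

Lemma conj_pairN z w : conj_pair z w -> conj_pair (- z) (- w).
Proof.
case=> U [V [-> ->]]; exists (- U), (- V).
by rewrite !rmorphN mulrN !opprD !opprK.
Qed.

Lemma conj_pairD z w z' w' :
  conj_pair z w -> conj_pair z' w' -> conj_pair (z + z') (w + w').
Proof.
case=> U [V [-> ->]] [U' [V' [-> ->]]]; exists (U + U'), (V + V').
rewrite !rmorphD /=; move: (U%:L) (V%:L) (U'%:L) (V'%:L) => u v u' v'.
by split; ring.
Qed.

Lemma conj_pairB z w z' w' :
  conj_pair z w -> conj_pair z' w' -> conj_pair (z - z') (w - w').
Proof. by move=> zw zw'; apply: conj_pairD => //; apply: conj_pairN. Qed.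

Lemma conj_pairM z w z' w' :
  conj_pair z w -> conj_pair z' w' -> conj_pair (z * z') (w * w').
Proof.
case=> U [V [-> ->]] [U' [V' [-> ->]]].
exists (U * U' + r * V * V'), (U * V' + V * U').
rewrite !rmorphD !rmorphM /= -Dl2.
move: (U%:L) (V%:L) (U'%:L) (V'%:L) => u v u' v'.
by split; ring.
Qed.

(** Horner induction: X is sent to a conjugate pair, and constants are fixed by both morphisms. *)
Lemma conj_pair_subst g : conj_pair (E1 g%:L) (E2 g%:L).
Proof.
elim/poly_ind: g => [|g c IHg].
  by rewrite !rmorph0 -(rmorph0 (@laurent_poly F)); apply: conj_pair_poly.
rewrite !rmorphD !rmorphM /= E1C E2C E1X E2X.
by apply: conj_pairD; [apply: conj_pairM => //; exists U0, V0 | apply: conj_pair_poly].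
Qed.

Lemma conj_pair_diff z w : conj_pair z w -> exists g, w - z = Dl * g%:L.
Proof.
case=> U [V [-> ->]]; exists (V *+ 2); rewrite rmorphMn /=.
by move: (U%:L) (V%:L) => u v; ring.
Qed.

(** Averaging the two expressions U - Delta V and U + Delta V of z cancels the part with Delta. *)
Lemma conj_pair_symmetric z :
  (2 : laurent F) != 0 -> conj_pair z z -> exists g, z = g%:L.
Proof.
move=> two [U [V [eU eV]]]; exists U; apply: (mulfI two).
by rewrite mulr_natl mulr2n {1}eU eV; move: (U%:L) (V%:L) => a b; ring.
Qed.

End ConjugatePairs.

(** * Structure relations *)

Section StructureRelations.
Variables (F : fieldType) (E1 E2 : {rmorphism laurent F -> laurent F}).
Variables (U0 V0 r : {poly F}) (Dl : laurent F).
Hypotheses (two : (2 : laurent F) != 0).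
Hypothesis E1_bigO : forall m (f : laurent F), bigO_pow m f -> bigO_pow m (E1 f).
Hypothesis E2_bigO : forall m (f : laurent F), bigO_pow m f -> bigO_pow m (E2 f).
Hypotheses (E1C : forall c : F, E1 c%:P%:L = c%:P%:L).
Hypotheses (E2C : forall c : F, E2 c%:P%:L = c%:P%:L).
Hypotheses (E1X : E1 'X%:L = U0%:L - Dl * V0%:L).
Hypotheses (E2X : E2 'X%:L = U0%:L + Dl * V0%:L).
Hypotheses (Dl2 : Dl ^+ 2 = r%:L) (Dl_neq0 : Dl != 0).
Variables (A B h D : {poly F}).
Variables (u : nat -> F) (P : nat -> {poly F}) (P1 : int -> {poly F}).
Let S := stieltjes u.
Let N (n : nat) := P1 (n%:Z - 1).
Hypotheses (hu : regular_moments u) (hP : monic_OPS S P P1).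

Let t := A%:L / Dl.
Let ricS := ric t B%:L h%:L D%:L (E1 S) 1 (E2 S) 1.

(** The relations of (b) at index n + 1: [l] stands for l_n + Delta pi_n, [N n.+1] for P1_n, and t
    (E2 g - E1 g) for A D g. *)
Definition structure_relations (l : laurent F) (th : {poly F}) n :=
  t * (E2 (P n.+1)%:L - E1 (P n.+1)%:L) =
    l * E1 (P n.+1)%:L - h%:L * E2 (P n.+1)%:L - B%:L * E2 (N n.+1)%:L
    + th%:L * E1 (P n)%:L
  /\ t * (E2 (N n.+1)%:L - E1 (N n.+1)%:L) =
    l * E1 (N n.+1)%:L + h%:L * E2 (N n.+1)%:L + D%:L * E2 (P n.+1)%:L
    + th%:L * E1 (N n)%:L.

Lemma wronskian_subst (E : {rmorphism laurent F -> laurent F}) n (k : F) :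
  (forall c : F, E c%:P%:L = c%:P%:L) -> wronskian P P1 n = k%:P ->
  k%:P%:L = E (N n)%:L * E (P n.+1)%:L - E (P n)%:L * E (N n.+1)%:L.
Proof. by move=> EC Wk; rewrite -EC -Wk /wronskian !rmorphB !rmorphM. Qed.

Let conj_substitution := conj_pair_subst E1C E2C E1X E2X Dl2.
Let conj_mul := conj_pairM Dl2.

Lemma divdiff_poly g : exists a, t * (E2 g%:L - E1 g%:L) = a%:L.
Proof.
have [a ->] := conj_pair_diff (conj_substitution g).
by exists (A * a); rewrite mulrA divfK // rmorphM.
Qed.

(** The symmetric part of [ric]. It preserves F[x] + Delta F[x], whereas the term with t = A / Delta
    has a denominator and is treated apart. *)
Let quad (X1 X0 Y1 Y0 : laurent F) :=
  B%:L * X1 * Y1 + h%:L * (X1 * Y0 + Y1 * X0) + D%:L * X0 * Y0.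

Lemma conj_pair_quad X1 X1' X0 X0' Y1 Y1' Y0 Y0' :
  conj_pair Dl X1 X1' -> conj_pair Dl X0 X0' ->
  conj_pair Dl Y1 Y1' -> conj_pair Dl Y0 Y0' ->
  conj_pair Dl (quad X1 X0 Y1 Y0) (quad X1' X0' Y1' Y0').
Proof.
have polyc g : conj_pair Dl g%:L g%:L := conj_pair_poly Dl g.
move=> hX1 hX0 hY1 hY0; apply: conj_pairD; first apply: conj_pairD.
- by apply: (conj_mul (conj_mul (polyc B) hX1) hY1).
- by apply: (conj_mul (polyc h)); apply: conj_pairD; apply: conj_mul.
by apply: (conj_mul (conj_mul (polyc D) hX0) hY0).
Qed.

(** On the diagonal the t-term is A / Delta times a difference of conjugates, hence a polynomial;
    the rest is its own conjugate by symmetry of [quad]. *)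
Lemma ric_diag_poly n :
  exists a, ricP E1 E2 t B%:L h%:L D%:L P P1 n n = a%:L.
Proof.
have PE := conj_substitution (P n); have NE := conj_substitution (N n).
have [a ea] : exists a, E2 (N n)%:L * E1 (P n)%:L - E1 (N n)%:L * E2 (P n)%:L = Dl * a%:L.
  by apply: conj_pair_diff; apply: conj_mul => //; apply: conj_pairC.
rewrite /ricP /ric ea mulrA divfK // -/N -/(quad _ _ _ _).
have [b ->] : exists b,
    quad (E1 (N n)%:L) (E1 (P n)%:L) (E2 (N n)%:L) (E2 (P n)%:L) = b%:L.
  apply: (conj_pair_symmetric (Dl := Dl)) => //.
  have := conj_pair_quad NE PE (conj_pairC NE) (conj_pairC PE).
  by congr (conj_pair _ _ _); rewrite /quad; ring.
by exists (A * a - b); rewrite rmorphB rmorphM.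
Qed.

(** Adding t k, with k written as the image of the Wronskian under E1, turns the t-term into E1 P_n
    t (E2 - E1) N_(n+1) - E1 N_n t (E2 - E1) P_(n+1), where the divided differences are polynomials.
    The second equation is the conjugate of the first. *)
Lemma ric_offdiag_poly n (k : F) : wronskian P P1 n = k%:P ->
  exists l pi : {poly F},
    ricP E1 E2 t B%:L h%:L D%:L P P1 n n.+1 + t * k%:P%:L = l%:L + Dl * pi%:L /\
    ricP E2 E1 (- t) B%:L h%:L D%:L P P1 n n.+1 - t * k%:P%:L = l%:L - Dl * pi%:L.
Proof.
move=> Wk; have k1 := wronskian_subst E1C Wk; have k2 := wronskian_subst E2C Wk.
have [p ep] := divdiff_poly (P n.+1); have [v ev] := divdiff_poly (N n.+1).
have NE := conj_substitution (N n); have PE := conj_substitution (P n).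
have NE' := conj_substitution (N n.+1); have PE' := conj_substitution (P n.+1).
have polyc g : conj_pair Dl g%:L g%:L := conj_pair_poly Dl g.
have [l [pi [eq2 eq1]]] : conj_pair Dl
    (E2 (P n)%:L * v%:L - E2 (N n)%:L * p%:L
     - quad (E2 (N n)%:L) (E2 (P n)%:L) (E1 (N n.+1)%:L) (E1 (P n.+1)%:L))
    (E1 (P n)%:L * v%:L - E1 (N n)%:L * p%:L
     - quad (E1 (N n)%:L) (E1 (P n)%:L) (E2 (N n.+1)%:L) (E2 (P n.+1)%:L)).
  apply: conj_pairB; last first.
    by apply: conj_pair_quad => //; apply: conj_pairC.
  by apply: conj_pairB; apply: conj_mul => //; apply: conj_pairC.
exists l, pi; rewrite -eq1 -eq2 -ep -ev; split.
  by rewrite k1 /ricP /ric /quad -/N; ring.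
by rewrite k2 /ricP /ric /quad -/N; ring.
Qed.

(** The Riccati equation and its conjugate bound both l + Delta pi and l - Delta pi, and therefore l
    and pi separately. *)
Lemma structure_relations_exist : ricS = 0 ->
  exists l pi th : nat -> {poly F},
    (exists K : nat, forall n,
       [/\ (size (l n) <= K)%N, (size (pi n) <= K)%N & (size (th n) <= K)%N]) /\
    forall n, structure_relations ((l n)%:L + Dl * (pi n)%:L) (th n) n.
Proof.
move=> ricS0; have ricS0' : ric (- t) B%:L h%:L D%:L (E2 S) 1 (E1 S) 1 = 0.
  by rewrite -ric_swap.
have [M1 ricM1] := ricP_bounded E1_bigO E2_bigO hP ricS0.
have [M2 ricM2] := ricP_bounded E2_bigO E1_bigO hP ricS0'.
have [M3 tM] := laurent_bound t.
(* [M4] serves to recover l as a half sum and pi as a half difference divided by Delta. All bounds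
   are fixed before n. *)
have [M4 [twoM DlM]] := laurent_bound2 (2^-1) (2^-1 / Dl).
pose M : int := (`|M1| + `|M2| + `|M3|)%N; pose K := (`|M1| + `|M2| + `|M3| + `|M4|)%N.
have dbl (z : laurent F) : z + z = 2 * z by rewrite mulr_natl mulr2n.
have step n : exists l pi th : {poly F},
    [/\ (size l <= K.+1)%N, (size pi <= K.+1)%N & (size th <= K.+1)%N] /\
    structure_relations (l%:L + Dl * pi%:L) th n.
  have [k k0 Wk] := wronskian_const hu hP n.
  have [a ea] := ric_diag_poly n.+1.
  have [l [pi [ep em]]] := ric_offdiag_poly Wk.
  have kL0 : k%:P%:L != 0.
    by rewrite -(rmorph0 (@laurent_poly F)) (inj_eq (@laurent_poly_inj F)) polyC_eq0.
  have kO : bigO_pow 0 k%:P%:L by apply: (@bigO_poly _ 0); rewrite size_polyC leq_b1.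
  have tkO : bigO_pow M (t * k%:P%:L).
    by have := bigO_powM tM kO; apply: bigO_pow_le; rewrite /M; lia.
  have pO : bigO_pow M (l%:L + Dl * pi%:L).
    rewrite -ep; apply: bigO_powD => //.
    have := ricM1 n n.+1 (ltnW (leqnSn n.+1)) (leqnn _).
    by apply: bigO_pow_le; rewrite /M; lia.
  have mO : bigO_pow M (l%:L - Dl * pi%:L).
    rewrite -em; apply: bigO_powB => //.
    have := ricM2 n n.+1 (ltnW (leqnSn n.+1)) (leqnn _).
    by apply: bigO_pow_le; rewrite /M; lia.
  have szl : (size l <= K.+1)%N.
    apply: size_bigO_poly.
    have -> : l%:L = 2^-1 * (l%:L + Dl * pi%:L + (l%:L - Dl * pi%:L)).
      by rewrite addrACA subrr addr0 dbl mulKf.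
    by have := bigO_powM twoM (bigO_powD pO mO); apply: bigO_pow_le; rewrite /K /M; lia.
  have szpi : (size pi <= K.+1)%N.
    apply: size_bigO_poly.
    have -> : pi%:L = 2^-1 / Dl * (l%:L + Dl * pi%:L - (l%:L - Dl * pi%:L)).
      rewrite opprB [l%:L + _]addrC -addrA [l%:L + _]addrCA subrr addr0.
      by rewrite dbl -mulrA [Dl^-1 * _]mulrCA !mulKf.
    by have := bigO_powM DlM (bigO_powB pO mO); apply: bigO_pow_le; rewrite /K /M; lia.
  have sza : (size a <= K.+1)%N.
    apply: size_bigO_poly; rewrite -ea.
    have := ricM1 n.+1 n.+1 (leqnSn _) (leqnSn _).
    by apply: bigO_pow_le; rewrite /K; lia.
  (* Here ric(E1 v_n, E2 v_(n+1)) + t k = l + Delta pi, so division by - k gives the Cramer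
     solution. *)
  exists (- k^-1 *: l), (- k^-1 *: pi), (k^-1 *: a); split.
    by split; apply: leq_trans (size_scale_leq _ _) _.
  have kV : (k^-1)%:P%:L * k%:P%:L = 1.
    by rewrite -rmorphM -polyCM mulVf // rmorph1.
  apply: (ric_solve kL0 (wronskian_subst E1C Wk)).
    by rewrite -mul_polyC rmorphM /= mulrAC kV mul1r -ea.
  rewrite -!mul_polyC !rmorphM !polyCN !rmorphN /= mulrCA -mulrDr -ep.
  rewrite mulrDl mulrAC mulNr kV mulN1r -/N.
  by rewrite /ricP -/N; ring.
have [l Hl] := choice step; have [pi Hpi] := choice Hl.
have [th Hth] := choice Hpi; exists l, pi, th; split.
  by exists K.+1 => n; have [] := Hth n.
by move=> n; have [] := Hth n.
Qed.

(** Elimination of l identifies the diagonal values of the form with k Theta, a polynomial of degree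
    at most K. *)
Lemma ricS_eq0_of_structure_relations
    (l : nat -> laurent F) (th : nat -> {poly F}) (K : nat) :
  (forall n, size (th n) <= K)%N -> (forall n, structure_relations (l n) (th n) n) ->
  ricS = 0.
Proof.
move=> thK rel; apply: (ricS_eq0 E1_bigO E2_bigO hP (M := K%:Z)) => n.
have [k k0 Wk] := wronskian_const hu hP n.
have [eqP eqN] := rel n.
rewrite /ricP -(ric_elim_l eqP eqN) -/N -(wronskian_subst E1C Wk).
rewrite -rmorphM mulrC mul_polyC.
apply: bigO_poly; apply: leq_trans (size_scale_leq _ _) _.
exact: leq_trans (thK n) _.
Qed.

Lemma structure_relations_second_kind (l : laurent F) (th : {poly F}) n :
  ricS = 0 -> structure_relations l th n ->
  t * (E2 (qfun u P P1 n.+1) - E1 (qfun u P P1 n.+1)) =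
    l * E1 (qfun u P P1 n.+1) + (B%:L * E1 S + h%:L) * E2 (qfun u P P1 n.+1)
    + th%:L * E1 (qfun u P P1 n).
Proof.
move=> ricS0 [eqP eqN]; have := ric_second_kind ricS0 eqP eqN.
by rewrite /qfun !rmorphB !rmorphM.
Qed.

End StructureRelations.

(** * Degrees of the two lattice roots *)

Section LatticeDegree.
Variables (F : fieldType) (a b c d e f : F) (s : laurent F).
Let lam := lattice_lambda a b c.
Hypotheses (ac_neq0 : a * c != 0) (lam_neq0 : lam != 0).
Hypothesis (s2 : s ^+ 2 = (lattice_r a b c d e f)%:L).

Let a_neq0 : a != 0. Proof. by apply: contraNneq ac_neq0 => ->; rewrite mul0r. Qed.

Lemma lattice_r_coef2 : (lattice_r a b c d e f)`_2 = lam / a ^+ 2.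
Proof.
by rewrite /lattice_r sqrrD -polyC_exp !coefE /= !(mulr0, mul0r, addr0, mulr1, mul0rn).
Qed.

Lemma size_lattice_r : (size (lattice_r a b c d e f) <= 3)%N.
Proof.
apply: leq_trans (size_polyD _ _) _; rewrite geq_max.
rewrite (leq_trans (size_polyC_leq1 _)) // andbT.
apply: leq_trans (size_scale_leq _ _) _; apply: leq_trans (size_poly_exp_leq _ _) _.
by rewrite size_XaddC.
Qed.

(** The leading exponent m of s satisfies 2 m = 2, because the coefficient of x^2 in r is nonzero
    and r has degree at most 2. *)
Lemma lattice_sqrt_lead : bigO_pow 1 s /\ s 1 ^+ 2 = lam / a ^+ 2.
Proof.
have r2 : (lattice_r a b c d e f)%:L 2 != 0.
  by rewrite -[X in X != 0]/(_`_2) lattice_r_coef2 mulf_neq0 ?invr_neq0 ?expf_neq0.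
have rO : bigO_pow 2 (lattice_r a b c d e f)%:L by apply: bigO_poly size_lattice_r.
have s0 : s != 0.
  by apply/eqP => s0; move: r2; rewrite -s2 s0 expr0n /= eqxx.
have [m sm s_m] := laurent_lead s0.
have ssm := coef_top_mul sm sm; have ssO := bigO_powM sm sm.
rewrite -expr2 s2 in ssm ssO.
have m_le : m + m <= 2.
  have r_mm : (lattice_r a b c d e f)%:L (m + m) != 0 by rewrite ssm mulf_neq0.
  exact: bigO_pow_lead r_mm rO.
have m_ge : 2 <= m + m := bigO_pow_lead r2 ssO.
have m1 : m = 1 by lia.
by rewrite m1 in sm ssm; split; rewrite // expr2 -ssm -lattice_r_coef2.
Qed.

Lemma bigO_lattice_p : bigO_pow 1 (lattice_p a b d)%:L.
Proof.
apply: bigO_poly; apply: leq_trans (size_scale_leq _ _) _.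
apply: leq_trans (size_polyD _ _) _; rewrite geq_max.
rewrite (leq_trans (size_polyC_leq1 _)) // andbT.
by apply: leq_trans (size_scale_leq _ _) _; rewrite size_polyX.
Qed.

(** The product of the two coefficients is (b^2 - lambda) / a^2 = a c / a^2, which is nonzero. So
    both roots have degree exactly 1 and can be substituted. *)
Lemma lattice_roots_lead :
  ((lattice_p a b d)%:L - s : laurent F) 1 != 0 /\
  ((lattice_p a b d)%:L + s : laurent F) 1 != 0.
Proof.
have [_ s1] := lattice_sqrt_lead.
have p1 : (lattice_p a b d)%:L 1 = - (b / a).
  by rewrite /= /lattice_p !coefE /= mulr1 addr0 mulNr mulrC.
apply/andP; rewrite -negb_or -mulf_eq0.
have -> : ((lattice_p a b d)%:L - s : laurent F) 1
    * ((lattice_p a b d)%:L + s : laurent F) 1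
    = ((lattice_p a b d)%:L 1 - s 1) * ((lattice_p a b d)%:L 1 + s 1) by [].
rewrite -subr_sqr s1 p1 sqrrN expr_div_n -mulrBl /lam /lattice_lambda subKr.
by rewrite mulf_neq0 // invr_neq0 // expf_neq0.
Qed.

End LatticeDegree.

(** * Equivalence of the Riccati equation with the structure relations on the lattice *)

Lemma half_poly (F : fieldType) (C : {poly F}) :
  (2 : F) != 0 -> C%:L / 2 = (2^-1 *: C)%:L.
Proof.
move=> two; have twoL := laurent_nat_neq0 two.
apply: (canLR (mulfK twoL)); rewrite -(rmorph_nat (@laurent_poly F)) -rmorphM.
by rewrite mulr_natr -scaler_nat scalerA mulfV // scale1r.
Qed.

Lemma second_kindE (F : fieldType) (u : nat -> F) (P : nat -> {poly F}) P1 (n : nat) :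
  monic_OPS (stieltjes u) P P1 ->
  second_kind (stieltjes u) P P1 n%:Z = qfun u P P1 n.
Proof.
move=> hP; case: n => [|n] //.
rewrite /qfun sub0r (OPS1_N1 hP) (rmorph0 (@laurent_poly F)) subr0.
suff -> : P 0%N = 1 by rewrite (rmorph1 (@laurent_poly F)) mul1r.
have /eqP := OPS_monic hP 0; rewrite lead_coefE (OPS_size hP) /= => P00.
by rewrite [LHS]size1_polyC ?(OPS_size hP) // P00.
Qed.

Theorem theorem1 (F : numClosedFieldType) (a b c d e f : F)
  (hac : a * c != 0)
  (hlt : lattice_lambda a b c * lattice_tau a b c d e f != 0)
  (s y1 y2 : laurent F)
  (hs : s ^+ 2 = (lattice_r a b c d e f)%:L)
  (hy1 : y1 = (lattice_p a b d)%:L - s)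
  (hy2 : y2 = (lattice_p a b d)%:L + s)
  (u : nat -> F) (hu : regular_moments u)
  (S : laurent F) (hS : S = stieltjes u)
  (P : nat -> {poly F}) (P1 : int -> {poly F}) (hP : monic_OPS S P P1)
  (q : int -> laurent F) (hq : q = second_kind S P P1)
  (A B C D : {poly F}) (hA : A != 0) :
  let E1 := lsubst y1 in
  let E2 := lsubst y2 in
  let DD := divdiff y1 y2 in
  let MM := average y1 y2 in
  let Delta := y2 - y1 in
  [<->
    (* (a) *)
    A%:L * DD S = B%:L * E1 S * E2 S + C%:L * MM S + D%:L;
    (* (b) *)
    exists l pi Theta : nat -> {poly F},
      (exists N : nat, forall n : nat,
         [/\ (size (l n) <= N)%N, (size (pi n) <= N)%N
           & (size (Theta n) <= N)%N]) /\
      (forall n : nat, (1 <= n)%N ->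
         A%:L * DD (P n)%:L =
           ((l n.-1)%:L + Delta * (pi n.-1)%:L) * E1 (P n)%:L
           - C%:L / 2 * E2 (P n)%:L
           - B%:L * E2 (P1 (n%:Z - 1))%:L
           + (Theta n.-1)%:L * E1 (P n.-1)%:L
         /\
         A%:L * DD (P1 (n%:Z - 1))%:L =
           ((l n.-1)%:L + Delta * (pi n.-1)%:L) * E1 (P1 (n%:Z - 1))%:L
           + C%:L / 2 * E2 (P1 (n%:Z - 1))%:L
           + D%:L * E2 (P n)%:L
           + (Theta n.-1)%:L * E1 (P1 (n%:Z - 2))%:L);
    (* (c) *)
    exists l pi Theta : int -> {poly F},
      (exists N : nat, forall n : int, -1 <= n ->
         [/\ (size (l n) <= N)%N, (size (pi n) <= N)%N
           & (size (Theta n) <= N)%N]) /\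
      [/\ l (-1) = 2^-1 *: C, pi (-1) = 0 & Theta (-1) = D] /\
      (forall n : nat,
         A%:L * DD (q n%:Z) =
           ((l (n%:Z - 1))%:L + Delta * (pi (n%:Z - 1))%:L) * E1 (q n%:Z)
           + (B%:L * E1 S + C%:L / 2) * E2 (q n%:Z)
           + (Theta (n%:Z - 1))%:L * E1 (q (n%:Z - 1)))
  ].
Proof.
subst S q; move=> E1 E2 DD MM Dl.
have two : (2 : F) != 0 by rewrite pnatr_eq0.
have twoL := laurent_nat_neq0 two.
have lam0 : lattice_lambda a b c != 0 by apply: contraNneq hlt => ->; rewrite mul0r.
have [s_le1 s_1] := lattice_sqrt_lead hac lam0 hs.
have [y1_1 y2_1] := lattice_roots_lead hac lam0 hs.
have pO := @bigO_lattice_p F a b d.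
have y1_le1 : bigO_pow 1 y1 by rewrite hy1; apply: bigO_powB.
have y2_le1 : bigO_pow 1 y2 by rewrite hy2; apply: bigO_powD.
rewrite -hy1 in y1_1; rewrite -hy2 in y2_1.
(* [e1] and [e2] are [E1] and [E2] equipped with their morphism structure. *)
pose e1 := lsubst_rmorphism y1_le1 y1_1; pose e2 := lsubst_rmorphism y2_le1 y2_1.
have e1O m (g : laurent F) : bigO_pow m g -> bigO_pow m (e1 g) by apply: bigO_lsubst.
have e2O m (g : laurent F) : bigO_pow m g -> bigO_pow m (e2 g) by apply: bigO_lsubst.
have e1C (k : F) : e1 k%:P%:L = k%:P%:L by apply: lsubstC.
have e2C (k : F) : e2 k%:P%:L = k%:P%:L by apply: lsubstC.
have DlE : Dl = 2 * s by rewrite /Dl hy1 hy2; ring.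
(* Since y_j = p -/+ Delta / 2, conjugation is applied with U0 = p, V0 = 1/2 and Delta^2 = 4 r. *)
have halfDl : Dl * (2^-1)%:P%:L = s.
  by rewrite DlE -alg_polyC -half_poly // rmorph1 mul1r mulrAC divff // mul1r.
have e1X : e1 'X%:L = (lattice_p a b d)%:L - Dl * (2^-1)%:P%:L.
  by rewrite halfDl -hy1; apply: lsubstX.
have e2X : e2 'X%:L = (lattice_p a b d)%:L + Dl * (2^-1)%:P%:L.
  by rewrite halfDl -hy2; apply: lsubstX.
have Dl2 : Dl ^+ 2 = (lattice_r a b c d e f *+ 4)%:L.
  by rewrite DlE rmorphMn /= -hs; ring.
have Dl0 : Dl != 0.
  rewrite DlE mulf_neq0 //; apply/eqP => s0; move/eqP: s_1.
  have : a != 0 by apply: contraNneq hac => ->; rewrite mul0r.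
  by rewrite s0 expr0n /= [0 == _]eq_sym mulf_eq0 (negPf lam0)
     invr_eq0 expf_eq0 /= => /negPf->.
pose t := A%:L / Dl; pose h := 2^-1 *: C.
have hE : C%:L / 2 = h%:L by apply: half_poly.
have ADE g : A%:L * DD g = t * (e2 g - e1 g) by rewrite /DD /divdiff mulrA mulrAC.
pose ricS := ric t B%:L h%:L D%:L (e1 (stieltjes u)) 1 (e2 (stieltjes u)) 1.
have riccatiE : ricS = 0 <-> A%:L * DD (stieltjes u) =
    B%:L * E1 (stieltjes u) * E2 (stieltjes u) + C%:L * MM (stieltjes u) + D%:L.
  have MME : C%:L * MM (stieltjes u) = h%:L * (e1 (stieltjes u) + e2 (stieltjes u)).
    by rewrite -hE mulrAC -mulrA.
  by rewrite (ADE (stieltjes u)) MME; apply: ric_affine_eq0.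
(* This is (c) at n = 0, with the prescribed values at -1 and q_(-1) = 1. *)
have initE : ricS = 0 <-> A%:L * DD (stieltjes u) =
    (h%:L + Dl * 0%:L) * E1 (stieltjes u)
    + (B%:L * E1 (stieltjes u) + h%:L) * E2 (stieltjes u) + D%:L * E1 1.
  rewrite (ADE (stieltjes u)) (rmorph0 (@laurent_poly F)) mulr0 addr0.
  by rewrite [E1 1](rmorph1 e1) mulr1; apply: ric_affine_eq0_split.
rewrite hE.
tfae.
- move/riccatiE => ricS0.
  have [l [pi [th [[K bd] rel]]]] :=
    structure_relations_exist twoL e1O e2O e1C e2C e1X e2X Dl2 Dl0 hu hP ricS0.
  exists l, pi, th; split; first by exists K.
  case=> // n _; have [eqP eqN] := rel n; rewrite !ADE.
  by rewrite (_ : n.+1%:Z - 2 = n%:Z - 1) //; lia.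
- case=> l [pi [th [[K bd] rel]]].
  have rel' n : structure_relations e1 e2 Dl A B h D P P1
      ((l n)%:L + Dl * (pi n)%:L) (th n) n.
    have := rel n.+1 isT; rewrite !ADE (_ : n.+1%:Z - 2 = n%:Z - 1) //; lia.
  have thK n : (size (th n) <= K)%N by have [] := bd n.
  have ricS0 := ricS_eq0_of_structure_relations e1O e2O e1C hu hP thK rel'.
  (* The sequences of (b) are extended to negative indices by the initial values C / 2, 0 and D. *)
  exists (fun z => if z is Posz n then l n else h).
  exists (fun z => if z is Posz n then pi n else 0).
  exists (fun z => if z is Posz n then th n else D).
  split; [|split].
  + exists (maxn K (maxn (size h) (size D))) => -[n|n] _.
      by have [lK piK thK'] := bd n; split; apply: leq_trans (leq_maxl _ _).
    by split; rewrite ?size_poly0 // !leq_max leqnn ?orbT.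
  + by [].
  case=> [|n]; first exact: (proj1 initE ricS0).
  rewrite (_ : n.+1%:Z - 1 = n%:Z); last by lia.
  rewrite !second_kindE // (ADE (qfun u P P1 n.+1)).
  exact: (structure_relations_second_kind ricS0 (rel' n)).
case=> l [pi [th [_ [[l0 pi0 th0] rel]]]].
by have := rel 0%N; rewrite sub0r l0 pi0 th0 => /initE/riccatiE.
Qed.
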